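(* Let $\alpha$ be a word consisting of $m$ letters $x$ and $n$ letters $y$, where $x,y$ satisfy the relations $yx=w(1,1)xy+1$, $x\,w(s,t)=w(s+1,t)\,x$, $y\,w(s,t)=w(s,t+1)\,y$ for all $s,t\in\mathbb{N}$. Then in this algebra \[ \alpha=\sum_{k=0}^{\min(m,n)} r_k(w;B_\alpha)\,x^{m-k}y^{n-k}. \]
   Context: $(w(s,t))_{s,t\in\mathbb{N}}$ are indeterminates; the algebra is the unital associative algebra generated by $x,y$ and the $w(s,t)$, the $w(s,t)$ commuting among themselves, subject to the three relations above. The Ferrers board $B_\alpha$ outlined by $\alpha$ is the set of cells $(i,j)$ (column $i$, row $j$) with $1\le i\le m$ and $1\le j\le h_i$, where $h_i$ is the number of $y$'s preceding the $i$-th $x$ in $\alpha$ (reading left to right). A placement of $k$ nonattacking rooks in a board $B$ is a $k$-subset of $B$ with no two cells in the same row or column; $\mathcal{N}_k(B)$ is the set of these. A rook cancels all cells to its right in the same row and all cells below it in the same column; $U_B(P)$ is the set of cells of $B\setminus P$ not cancelled by any rook of $P$. For a cell $(i,j)$, $r_{P,(i,j)}$ is the number of rooks of $P$ in the north-west region of $(i,j)$, i.e. at cells $(i',j')$ with $i'<i$ and $j'>j$. The weighted rook number is $r_k(w;B)=\sum_{P\in\mathcal{N}_k(B)}\prod_{(s,t)\in U_B(P)}w(s-r_{P,(s,t)},t)$. *)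

(* Defs.v *)
From HB Require Import structures.
From mathcomp Require Import all_boot all_algebra.
From mathcomp Require Import generic_quotient ring_quotient boolp monalg.

Set Implicit Arguments.
Unset Strict Implicit.
Unset Printing Implicit Defensive.

Import GRing.Theory.
Local Open Scope ring_scope.
Local Open Scope quotient_scope.

Variant letter := LX | LY.

Definition bool_of_letter (l : letter) : bool := if l is LX then true else false.
Definition letter_of_bool (b : bool) : letter := if b then LX else LY.
Lemma bool_of_letterK : cancel bool_of_letter letter_of_bool.
Proof. by case. Qed.
HB.instance Definition _ := Countable.copy letter (can_type bool_of_letterK).

(* The generators x, y and w(s, t).  Weights are indexed by positive integers
   s, t; the generator inr (i, j) stands for w(i + 1, j + 1). *)
Notation wgen := (letter + nat * nat)%type.

Notation free_alg K := {malg K[{fmonom wgen}]}.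

Section WeightAlgebra.

Variable K : comNzRingType.

Definition fgen (g : wgen) : free_alg K := << fmu g >>.

Local Notation X := (fgen (inl LX)).
Local Notation Y := (fgen (inl LY)).
Local Notation W i j := (fgen (inr (i, j))).

Inductive relator : free_alg K -> Prop :=
| rel_yx : relator (Y * X - (W 0 0 * X * Y + 1))
| rel_xw i j : relator (X * W i j - W i.+1 j * X)
| rel_yw i j : relator (Y * W i j - W i j.+1 * Y)
| rel_ww i j k l : relator (W i j * W k l - W k l * W i j).

(* The two-sided ideal generated by the relators. *)
Inductive rel_ideal : free_alg K -> Prop :=
| rel_ideal_gen u : relator u -> rel_ideal u
| rel_ideal0 : rel_ideal 0
| rel_idealD u v : rel_ideal u -> rel_ideal v -> rel_ideal (u + v)
| rel_idealMl a u : rel_ideal u -> rel_ideal (a * u)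
| rel_idealMr a u : rel_ideal u -> rel_ideal (u * a).

Definition rel_pred : {pred free_alg K} := fun u => `[< rel_ideal u >].

Lemma rel_predP u : reflect (rel_ideal u) (u \in rel_pred).
Proof. exact: asboolP. Qed.

Lemma rel_pred_zmod : zmod_closed rel_pred.
Proof.
split=> [|u v /rel_predP Iu /rel_predP Iv]; apply/rel_predP.
  exact: rel_ideal0.
by apply: rel_idealD => //; rewrite -mulN1r; apply: rel_idealMl.
Qed.

HB.instance Definition _ := GRing.isZmodClosed.Build _ rel_pred rel_pred_zmod.

Definition walg : Type := {ideal_quot rel_pred}.
HB.instance Definition _ := GRing.Zmodule.on walg.

Definition walg_pi (u : free_alg K) : walg := \pi_{ideal_quot rel_pred} u.

Lemma walg_piP u v : reflect (walg_pi u = walg_pi v) (u - v \in rel_pred).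
Proof. by rewrite /walg_pi Quotient.idealrBE; apply: eqP. Qed.

Lemma walg_repr (p : walg) : walg_pi (repr (p : {ideal_quot rel_pred})) = p.
Proof. exact: reprK. Qed.

Lemma walg_ind (P : walg -> Prop) : (forall u, P (walg_pi u)) -> forall p, P p.
Proof. by move=> Ppi p; rewrite -[p]walg_repr. Qed.

Lemma walg_piD u v : walg_pi (u + v) = walg_pi u + walg_pi v.
Proof. exact: (raddfD (\pi_{ideal_quot rel_pred})). Qed.

Definition walg_one : walg := walg_pi 1.
Definition walg_mul (p q : walg) : walg :=
  walg_pi (repr (p : {ideal_quot rel_pred}) * repr (q : {ideal_quot rel_pred})).
Definition walg_scale (c : K) (p : walg) : walg :=
  walg_pi (c *: repr (p : {ideal_quot rel_pred})).

Lemma walg_mul_pi u v : walg_mul (walg_pi u) (walg_pi v) = walg_pi (u * v).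
Proof.
rewrite /walg_mul; set u' := repr _; set v' := repr _.
apply/walg_piP/rel_predP.
have /walg_piP/rel_predP Iu : walg_pi u' = walg_pi u by apply: walg_repr.
have /walg_piP/rel_predP Iv : walg_pi v' = walg_pi v by apply: walg_repr.
rewrite -[X in X - _](subrK (u' * v)) -mulrBr -addrA -mulrBl.
by apply: rel_idealD; [apply: rel_idealMl | apply: rel_idealMr].
Qed.

Lemma walg_scale_pi c u : walg_scale c (walg_pi u) = walg_pi (c *: u).
Proof.
rewrite /walg_scale; set u' := repr _.
apply/walg_piP/rel_predP.
have /walg_piP/rel_predP Iu : walg_pi u' = walg_pi u by apply: walg_repr.
by rewrite -scalerBr -mul_malgC; apply: rel_idealMl.
Qed.

Lemma walg_mulA : associative walg_mul.
Proof.
elim/walg_ind=> u; elim/walg_ind=> v; elim/walg_ind=> t.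
by rewrite !walg_mul_pi mulrA.
Qed.

Lemma walg_mul1 : left_id walg_one walg_mul.
Proof. by elim/walg_ind=> u; rewrite walg_mul_pi mul1r. Qed.

Lemma walg_mulr1 : right_id walg_one walg_mul.
Proof. by elim/walg_ind=> u; rewrite walg_mul_pi mulr1. Qed.

Lemma walg_mulDl : left_distributive walg_mul +%R.
Proof.
elim/walg_ind=> u; elim/walg_ind=> v; elim/walg_ind=> t.
by rewrite -walg_piD !walg_mul_pi -walg_piD mulrDl.
Qed.

Lemma walg_mulDr : right_distributive walg_mul +%R.
Proof.
elim/walg_ind=> u; elim/walg_ind=> v; elim/walg_ind=> t.
by rewrite -walg_piD !walg_mul_pi -walg_piD mulrDr.
Qed.

(* x, y |-> 1 and w(s, t) |-> 0 respects the relations, so 1 != 0. *)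
Definition aug_gen (g : wgen) : K := if g is inl _ then 1 else 0.
Definition aug_monom (m : {fmonom wgen}) : K := \prod_(g <- (m : seq wgen)) aug_gen g.

Lemma aug_monom_mmorphism : mmorphism aug_monom.
Proof.
by split=> [m1 m2|]; rewrite /aug_monom ?fm1 ?big_nil // fmM big_cat.
Qed.
HB.instance Definition _ :=
  isMultiplicative.Build {fmonom wgen} K aug_monom aug_monom_mmorphism.

Definition aug : {rmorphism free_alg K -> K} := mmap idfun aug_monom.

Lemma aug_fgen g : aug (fgen g) = aug_gen g.
Proof.
apply: (etrans (mmapU (1 : K) (fmu g))).
by rewrite /= mul1r /aug_monom fmU big_seq1.
Qed.

Lemma aug_relator u : relator u -> aug u = 0.
Proof.
have morph_yx (R : nzRingType) (f : {rmorphism R -> K}) (x y w : R) :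
  f (y * x - (w * x * y + 1)) = f y * f x - (f w * f x * f y + 1).
  by rewrite rmorphB rmorphD !rmorphM rmorph1.
have morph_comm (R : nzRingType) (f : {rmorphism R -> K}) (a b c d : R) :
  f (a * b - c * d) = f a * f b - f c * f d.
  by rewrite rmorphB !rmorphM.
case=> [|i j|i j|i j k l].
- by apply: (etrans (morph_yx _ aug _ _ _)); rewrite !aug_fgen /= !mul0r add0r mul1r subrr.
- by apply: (etrans (morph_comm _ aug _ _ _ _)); rewrite !aug_fgen /= mulr0 mul0r subrr.
- by apply: (etrans (morph_comm _ aug _ _ _ _)); rewrite !aug_fgen /= mulr0 mul0r subrr.
- by apply: (etrans (morph_comm _ aug _ _ _ _)); rewrite !aug_fgen /= mulr0 subrr.
Qed.

Lemma aug_rel_ideal u : rel_ideal u -> aug u = 0.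
Proof.
elim=> [v /aug_relator //||v t _ augv _ augt|a v _ augv|v a _ augv].
- exact: rmorph0.
- by rewrite rmorphD augv augt addr0.
- by rewrite rmorphM augv mulr0.
- by rewrite rmorphM augv mul0r.
Qed.

Lemma walg_one_neq0 : walg_one != 0.
Proof.
have pi0 : walg_pi 0 = 0 by exact: (raddf0 (\pi_{ideal_quot rel_pred})).
apply/eqP; rewrite -pi0 => /walg_piP/rel_predP/aug_rel_ideal.
by rewrite subr0 rmorph1 => /eqP; rewrite oner_eq0.
Qed.

HB.instance Definition _ := GRing.Zmodule_isNzRing.Build walg
  walg_mulA walg_mul1 walg_mulr1 walg_mulDl walg_mulDr walg_one_neq0.

Lemma walg_scaleA a b p : walg_scale a (walg_scale b p) = walg_scale (a * b) p.
Proof. by elim/walg_ind: p => u; rewrite !walg_scale_pi scalerA. Qed.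

Lemma walg_scale1 : left_id 1 walg_scale.
Proof. by elim/walg_ind=> u; rewrite walg_scale_pi scale1r. Qed.

Lemma walg_scaleDr : right_distributive walg_scale +%R.
Proof.
move=> c; elim/walg_ind=> u; elim/walg_ind=> v.
by rewrite -walg_piD !walg_scale_pi -walg_piD scalerDr.
Qed.

Lemma walg_scaleDl p : {morph walg_scale^~ p : a b / a + b}.
Proof.
move=> a b; elim/walg_ind: p => u.
by rewrite !walg_scale_pi -walg_piD scalerDl.
Qed.

HB.instance Definition _ := GRing.Zmodule_isLmodule.Build K walg
  walg_scaleA walg_scale1 walg_scaleDr walg_scaleDl.

Lemma walg_piM u v : walg_pi (u * v) = walg_pi u * walg_pi v.
Proof. by rewrite -walg_mul_pi. Qed.

Lemma walg_piZ c u : walg_pi (c *: u) = c *: walg_pi u.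
Proof. by rewrite -walg_scale_pi. Qed.

Lemma walg_scaleAl (c : K) (p q : walg) : c *: (p * q) = (c *: p) * q.
Proof.
elim/walg_ind: p => u; elim/walg_ind: q => v.
by rewrite -walg_piM -!walg_piZ -walg_piM scalerAl.
Qed.

HB.instance Definition _ := GRing.Lmodule_isLalgebra.Build K walg walg_scaleAl.

Lemma malg_scaleAr (c : K) (u v : free_alg K) : c *: (u * v) = u * (c *: v).
Proof.
rewrite [u]monalgE mulr_suml scaler_sumr mulr_suml; apply: eq_bigr => k1 _.
rewrite [v]monalgE mulr_sumr !scaler_sumr mulr_sumr; apply: eq_bigr => k2 _.
rewrite -!mul_malgC !malgM_def !fgmulUU !mul1m.
by rewrite mulrCA.
Qed.

Lemma walg_scaleAr (c : K) (p q : walg) : c *: (p * q) = p * (c *: q).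
Proof.
elim/walg_ind: p => u; elim/walg_ind: q => v.
by rewrite -walg_piM -!walg_piZ -walg_piM malg_scaleAr.
Qed.

HB.instance Definition _ := GRing.Lalgebra_isAlgebra.Build K walg walg_scaleAr.

Definition xW : walg := walg_pi X.
Definition yW : walg := walg_pi Y.
(* w(s, t), meant for s, t >= 1. *)
Definition wW (s t : nat) : walg := walg_pi (W s.-1 t.-1).

Lemma yx_walg : yW * xW = wW 1 1 * xW * yW + 1.
Proof.
rewrite /yW /xW /wW /= -!walg_piM.
rewrite (_ : (1 : walg) = walg_pi 1) // -walg_piD.
by apply/walg_piP/rel_predP/rel_ideal_gen; exact: rel_yx.
Qed.

Lemma xw_walg s t : (0 < s)%N -> (0 < t)%N -> xW * wW s t = wW s.+1 t * xW.
Proof.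
move=> s0 _; rewrite /wW -{2}(prednK s0) -(walg_piM X) -(walg_piM _ X).
by apply/walg_piP/rel_predP/rel_ideal_gen; exact: rel_xw.
Qed.

Lemma yw_walg s t : (0 < s)%N -> (0 < t)%N -> yW * wW s t = wW s t.+1 * yW.
Proof.
move=> _ t0; rewrite /wW -{2}(prednK t0) -(walg_piM Y) -(walg_piM _ Y).
by apply/walg_piP/rel_predP/rel_ideal_gen; exact: rel_yw.
Qed.

Lemma ww_walg s t s' t' : wW s t * wW s' t' = wW s' t' * wW s t.
Proof.
rewrite /wW -!walg_piM.
by apply/walg_piP/rel_predP/rel_ideal_gen; exact: rel_ww.
Qed.

Definition letter_val (l : letter) : walg := if l is LX then xW else yW.

Definition word_val (alpha : seq letter) : walg :=
  \prod_(l <- alpha) letter_val l.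

End WeightAlgebra.

Arguments xW {K}.
Arguments yW {K}.
Arguments wW {K} s t.

Section Rooks.

Variables m n : nat.

(* The pair (i, j) stands for the cell in column i + 1 and row j + 1. *)
Local Notation cell := ('I_m * 'I_n)%type.
Implicit Types (B P : {set cell}) (c d : cell).

(* The number of y's preceding the letter x number i, counted from 0. *)
Definition height (alpha : seq letter) (i : nat) : nat :=
  let xpos := [seq p <- iota 0 (size alpha) | nth LY alpha p == LX] in
  count_mem LY (take (nth 0%N xpos i) alpha).

Definition board (alpha : seq letter) : {set cell} :=
  [set c : cell | (c.2 < height alpha c.1)%N].

Definition nonattacking P : bool :=
  [forall c in P, forall d in P, (c != d) ==> (c.1 != d.1) && (c.2 != d.2)].

Definition placements (k : nat) B : {set {set cell}} :=
  [set P : {set cell} | [&& P \subset B, #|P| == k & nonattacking P]].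

(* Rows are numbered upwards: the cells below d have a smaller row index. *)
Definition cancels d c : bool :=
  ((d.2 == c.2) && (d.1 < c.1)%N) || ((d.1 == c.1) && (c.2 < d.2)%N).

Definition uncancelled B P : {set cell} :=
  [set c in B :\: P | [forall d in P, ~~ cancels d c]].

Definition rooks_nw P c : nat :=
  #|[set d in P | (d.1 < c.1)%N && (c.2 < d.2)%N]|.

(* The factors w s t commute in the intended use, so the order in which
   \prod enumerates the cells does not matter.  At most i rooks lie in the
   columns left of column i + 1, so the first index stays positive. *)
Definition rook_number (A : pzRingType) (w : nat -> nat -> A) (k : nat) B : A :=
  \sum_(P in placements k B)
    \prod_(c in uncancelled B P) w (c.1.+1 - rooks_nw P c)%N c.2.+1.

End Rooks.

Arguments board m n alpha : clear implicits.

(* Main.v *)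
(* Comparing the two ways of moving a weight across y x shows that the relations force
   w(s+1, t+1) = w(s, t).  Induct on the prefixes of the word, summing over all
   placements at once.  A letter y only adds an empty row.  A letter x adds a column of
   full height: a placement on the old board extends by no rook or by one rook in a free
   row of the new column, and these are the terms produced when the trailing power of y is
   normally ordered past x, the t-th y from the right being matched with the t-th free row
   from the bottom.  The weights agree thanks to the diagonal invariance above.

   All boards live in the fixed grid of the full word, prefixes being cut out by
   column, so that the types of cells never change. *)
Require Import Defs.
From mathcomp Require Import all_boot all_algebra.
From mathcomp Require Import zify.
Import GRing.Theory.
Local Open Scope ring_scope.

(** * Products of pairwise commuting elements in a noncommutative ring *)

Section CommutingProducts.

Context {R : pzRingType} {I : eqType}.
Variable F : I -> R.
Hypothesis F_comm : forall i j, GRing.comm (F i) (F j).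

(** The head of [r1] is pulled to the front of [r2], since it commutes with every factor before
    it. *)
Lemma prod_comm_perm (r1 r2 : seq I) :
  perm_eq r1 r2 -> \prod_(i <- r1) F i = \prod_(i <- r2) F i.
Proof.
elim: r1 r2 => [|a r1 IH] r2 pr; first by move: pr; rewrite perm_sym => /perm_nilP ->.
have /path.splitPr ar2 : a \in r2 by rewrite -(perm_mem pr) mem_head.
case: ar2 pr => p q; rewrite perm_sym perm_catC cat_cons perm_cons perm_catC => pr.
rewrite big_cons (IH (p ++ q)) 1?perm_sym // !big_cat big_cons /= !mulrA.
by congr (_ * _); apply: commr_prod => i _; exact: F_comm.
Qed.

End CommutingProducts.

Lemma prod_comm_setU {R : pzRingType} {T : finType} (F : T -> R) (A B : {set T}) :
  (forall i j, GRing.comm (F i) (F j)) -> [disjoint A & B] ->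
  \prod_(i in A :|: B) F i = (\prod_(i in A) F i) * \prod_(i in B) F i.
Proof.
move=> Fc dAB; rewrite -!(big_filter (index_enum T)) -big_cat /=.
apply: prod_comm_perm => //; apply: uniq_perm.
- exact: filter_uniq (index_enum_uniq T).
- rewrite cat_uniq !filter_uniq ?index_enum_uniq //= andbT; apply/hasPn => x.
  rewrite !mem_filter => /andP[xB _]; apply/negP => /andP[xA _].
  by move/pred0P/(_ x): dAB; rewrite /= xA xB.
- by move=> x; rewrite mem_cat !mem_filter mem_index_enum !andbT inE.
Qed.

Lemma prod_comm_imset {R : pzRingType} {S T : finType} (F : T -> R) (h : S -> T) (A : {set S}) :
  (forall i j, GRing.comm (F i) (F j)) -> injective h ->
  \prod_(i in h @: A) F i = \prod_(i in A) F (h i).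
Proof.
move=> Fc hI.
rewrite -(big_filter (index_enum T)) -(big_filter (index_enum S)) -(big_map h xpredT) /=.
apply: prod_comm_perm => //; apply: uniq_perm.
- exact: filter_uniq (index_enum_uniq T).
- by rewrite map_inj_uniq ?filter_uniq ?index_enum_uniq.
move=> x; rewrite mem_filter mem_index_enum andbT.
apply/imsetP/mapP => -[y yA ->]; exists y => //.
  by rewrite mem_filter yA mem_index_enum.
by move: yA; rewrite mem_filter => /andP[].
Qed.

(** * Normal ordering of [x], [y] and the weights *)

Section NormalOrdering.

Context {R : pzRingType}.
Variables (x y : R) (w : nat -> nat -> R).
Hypothesis yx : y * x = w 1 1 * x * y + 1.
Hypothesis xw : forall s t, (0 < s)%N -> (0 < t)%N -> x * w s t = w s.+1 t * x.
Hypothesis yw : forall s t, (0 < s)%N -> (0 < t)%N -> y * w s t = w s t.+1 * y.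
Hypothesis ww : forall s t s' t', w s t * w s' t' = w s' t' * w s t.

Lemma weight_diag (s t : nat) : w s.+2 t.+2 = w s.+1 t.+1.
Proof.
have: (y * x) * w s.+1 t.+1 = w s.+2 t.+2 * (y * x).
  by rewrite -mulrA xw // mulrA yw // mulrA.
(* Expanding [y * x] gives both sides the same multiple of [x * y], as weights commute; cancelling
   it leaves the two weights coming from the [1]. *)
rewrite yx mulrDl mulrDr mul1r mulr1 -!mulrA yw // (mulrA x) xw //.
by rewrite !mulrA (ww 1 1) => /addrI.
Qed.

Lemma weight_shift (c s t : nat) : w (s + c).+1 (t + c).+1 = w s.+1 t.+1.
Proof. by elim: c => [|c IH]; rewrite ?addn0 // !addnS weight_diag. Qed.

Lemma expX_weight (a s t : nat) : x ^+ a * w s.+1 t.+1 = w (s + a).+1 t.+1 * x ^+ a.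
Proof.
elim: a => [|a IH]; first by rewrite expr0 mulr1 mul1r addn0.
by rewrite exprS -mulrA IH mulrA xw // -mulrA addnS.
Qed.

Lemma expY_weight (b s t : nat) : y ^+ b * w s.+1 t.+1 = w s.+1 (t + b).+1 * y ^+ b.
Proof.
elim: b => [|b IH]; first by rewrite expr0 mulr1 mul1r addn0.
by rewrite exprS -mulrA IH mulrA yw // -mulrA addnS.
Qed.

Lemma expX_prod_weight {J : Type} (r : seq J) (Q : pred J) (a : nat) (u : J -> nat) :
  x ^+ a * (\prod_(j <- r | Q j) w 1 (u j).+1) =
  (\prod_(j <- r | Q j) w a.+1 (u j).+1) * x ^+ a.
Proof.
elim: r => [|j r IH]; first by rewrite !big_nil mulr1 mul1r.
by rewrite !big_cons; case: (Q j); rewrite // mulrA expX_weight add0n -!mulrA IH.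
Qed.

(** Each free row below [N] stands for one factor [y], so induction on [N] adds a [y] on the right
    exactly when the new row is free. The first term will match an empty new column, the summand [j]
    a new rook in row [j]. *)
Lemma expY_X (free : pred nat) (N : nat) (rank := fun j => count free (iota 0 j)) :
  y ^+ rank N * x =
    (\prod_(j < N | free j) w 1 (rank j).+1) * x * y ^+ rank N +
    \sum_(j < N | free j)
      (\prod_(j' < N | free j' && (j < j')%N) w 1 (rank j').+1) * y ^+ (rank N).-1.
Proof.
have rankS M : rank M.+1 = (rank M + free M)%N.
  by rewrite /rank -addn1 iotaD count_cat /= addn0.
elim: N => [|N IH]; first by rewrite /rank /= !big_ord0 mul1r addr0 mulr1.
have prodS (Q : pred nat) : \prod_(j < N.+1 | Q j) w 1 (rank j).+1 =
    (\prod_(j < N | Q j) w 1 (rank j).+1) * (if Q N then w 1 (rank N).+1 else 1).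
  by rewrite !big_mkcond big_ord_recr /= -big_mkcond.
rewrite prodS [X in _ + X]big_mkcond big_ord_recr /= -[X in _ + (X + _)]big_mkcond (prodS (fun j' => free j' && (N < j')%N)).
under [X in _ + (X + _)]eq_bigr => j _ do rewrite (prodS (fun j' => free j' && (j < j')%N)) ltn_ord andbT.
rewrite rankS ltnn andbF mulr1; case freeN: (free N); last first.
  by rewrite addn0 mulr1 addr0 IH; congr (_ + _); apply: eq_bigr => j _; rewrite mulr1.
(* Row [N] is free: the last [y] meets [x]. The resulting [w 1 1] becomes [w 1 (rank N).+1] on
   passing [y ^+ rank N], and the [1] yields the summand of row [N]. *)
rewrite addn1 exprSr -mulrA yx mulrDr mulr1 -!mulrA mulrA (expY_weight _ 0 0) add0n.
rewrite -mulrA (mulrA _ x) IH mulrDl mulrDr mulr_suml mulr_sumr -addrA; congr (_ + _).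
  rewrite !mulrA; congr (_ * _ * _ * _); apply: commr_prod => j _; exact: ww.
congr (_ + _); last first.
  by rewrite big_pred0 ?mul1r // => j; rewrite [(N < j)%N]ltnNge ltnW ?ltn_ord ?andbF.
(* The free row [j] below [N] makes [rank N] positive, so its predecessor is not truncated. *)
apply: eq_bigr => j freej; rewrite -mulrA -exprSr prednK; last first.
  rewrite /rank -has_count; apply/hasP; exists (val j) => //.
  by rewrite mem_iota /= add0n ltn_ord.
rewrite mulrA; congr (_ * _); apply: commr_prod => j' _; exact: ww.
Qed.

End NormalOrdering.

Lemma card_le_bound {T : finType} (Q : {set T}) (f : T -> nat) (a : nat) :
  {in Q &, injective f} -> (forall d, d \in Q -> f d < a)%N -> (#|Q| <= a)%N.
Proof.
move=> fI fa; rewrite cardE -(size_map f) -(size_iota 0 a); apply: uniq_leq_size.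
  by rewrite map_inj_in_uniq ?enum_uniq // => c d; rewrite !mem_enum; apply: fI.
by move=> _ /mapP[d dQ ->]; rewrite mem_iota /= add0n fa // -mem_enum.
Qed.

(** * Nonattacking placements and their free rows *)

Section Placements.

Context {m n : nat}.
Local Notation cell := ('I_m * 'I_n)%type.
Implicit Types (B P Q : {set cell}) (c d : cell).

Lemma nonattackingP P :
  reflect ({in P &, injective fst} /\ {in P &, injective snd}) (nonattacking P).
Proof.
apply: (iffP idP) => [naP|[I1 I2]].
  have naE c d : c \in P -> d \in P -> c != d -> (c.1 != d.1) && (c.2 != d.2).
    move=> cP dP; apply/implyP; move: naP.
    by move/forall_inP/(_ c cP)/forall_inP/(_ d dP).
  by split=> c d cP dP /eqP e; apply/eqP/negPn/negP => /(naE c d cP dP); rewrite e ?andbF.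
apply/forall_inP => c cP; apply/forall_inP => d dP; apply/implyP => ncd.
by apply/andP; split; apply: contra ncd => /eqP e; apply/eqP; [apply: I1|apply: I2].
Qed.

Lemma nonattackingS P Q : P \subset Q -> nonattacking Q -> nonattacking P.
Proof.
move=> /subsetP PQ /nonattackingP[I1 I2]; apply/nonattackingP.
by split=> c d /PQ cQ /PQ dQ; [apply: I1|apply: I2].
Qed.

Definition free_row Q (j : nat) : bool := [forall d in Q, (d.2 : nat) != j].

(** Rooks occupy distinct rows, so the occupied rows below [j] are as many as the rooks there. *)
Lemma count_free_row Q (j : nat) : nonattacking Q ->
  (count (free_row Q) (iota 0 j) + #|[set d in Q | (d.2 < j)%N]|)%N = j.
Proof.
move=> /nonattackingP[_ I2]; rewrite -[RHS](size_iota 0 j) -(count_predC (free_row Q)).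
congr addn; rewrite -size_filter cardE -(size_map (fun d : cell => d.2 : nat)).
apply: perm_size; apply: uniq_perm.
- rewrite map_inj_in_uniq ?enum_uniq // => c d; rewrite !mem_enum !inE.
  by move=> /andP[cQ _] /andP[dQ _] /val_inj; apply: I2.
- exact/filter_uniq/iota_uniq.
move=> k; rewrite mem_filter mem_iota /= add0n negb_forall.
apply/mapP/andP => [[d] | [/existsP[d]]].
  rewrite mem_enum inE => /andP[dQ dj] ->; split=> //.
  by apply/existsP; exists d; rewrite dQ /= eqxx.
rewrite negb_imply negbK => /andP[dQ /eqP <-] dj.
by exists d => //; rewrite mem_enum inE dQ.
Qed.

End Placements.

Definition placement_weight {R : pzRingType} {m n : nat} (w : nat -> nat -> R)
    (B P : {set 'I_m * 'I_n}) : R :=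
  \prod_(c in uncancelled B P) w (c.1.+1 - rooks_nw P c)%N c.2.+1.

(** The exponents [a] and [b] are independent of the grid size, so that a prefix of the word can be
    expanded inside the grid of the full word. *)
Definition expansion {R : pzRingType} {m n : nat} (w : nat -> nat -> R) (x y : R)
    (a b : nat) (B : {set 'I_m * 'I_n}) : R :=
  \sum_(P : {set 'I_m * 'I_n} | (P \subset B) && nonattacking P)
    placement_weight w B P * x ^+ (a - #|P|) * y ^+ (b - #|P|).

(** * Adding a full column to the right of a board *)

Section AddColumn.

Context {m n : nat}.
Local Notation cell := ('I_m * 'I_n)%type.
Variables (B : {set cell}) (i : 'I_m) (N : nat).
Hypothesis Nn : (N <= n)%N.
Hypothesis B_left : forall c : cell, c \in B -> (c.1 < i)%N.
Hypothesis B_low : forall c : cell, c \in B -> (c.2 < N)%N.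

Let C : {set cell} := [set c : cell | (c.1 == i) && (c.2 < N)%N].

Definition above_new (P : {set cell}) (j : nat) : bool :=
  [forall d in P, (d.1 == i) ==> (d.2 < j)%N].

(** A rook in the new column cancels nothing in [B], which lies to its left. A new cell is cancelled
    from the left by any rook of [B] in its row, and from above by a rook of its own column. *)
Lemma uncancelled_column (P : {set cell}) : P \subset B :|: C ->
  uncancelled (B :|: C) P = uncancelled B (P :&: B) :|:
    (pair i @: [set j : 'I_n | [&& (j < N)%N, free_row (P :&: B) j & above_new P j]]).
Proof.
move=> /subsetP PBC; apply/setP => -[a b]; rewrite [in RHS]inE.
have -> : ((a, b) \in pair i @: [set j : 'I_n | [&& (j < N)%N, free_row (P :&: B) j & above_new P j]])
     = [&& a == i, (b < N)%N, free_row (P :&: B) b & above_new P b].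
  apply/imsetP/andP => [[j jC [-> ->]]|[/eqP -> bC]]; first by move: jC; rewrite inE eqxx.
  by exists b; rewrite ?inE.
rewrite !inE /=; have [abB|abB] /= := boolP ((a, b) \in B).
  have ai := B_left _ abB; rewrite /= in ai.
  have /negbTE -> /= : a != i by apply: contraTneq ai => ->; rewrite ltnn.
  rewrite !andbT orbF; congr (_ && _); apply/forall_inP/forall_inP => H d.
    by rewrite inE => /andP[dP _]; apply: H.
  move=> dP; have := PBC _ dP; rewrite inE => /orP[dB|]; first by apply: H; rewrite inE dP.
  rewrite inE => /andP[/eqP di _]; rewrite /cancels /= di.
  apply/negP => /orP[/andP[_]|/andP[/eqP e]]; first lia.
  by rewrite e ltnn in ai.
rewrite !andbF /=; case: eqP => [->{a abB}|_] /=; last by rewrite andbF.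
case bN: (b < N)%N; rewrite /= ?andbF // andbT.
apply/andP/andP => -[].
  move=> ibP /forall_inP H; split; apply/forall_inP => d.
    rewrite inE => /andP[dP dB]; have := H d dP; rewrite /cancels /= (B_left _ dB) andbT.
    by rewrite negb_or => /andP[].
  move=> dP; apply/implyP => /eqP di; have := H d dP; rewrite /cancels /= di eqxx /=.
  (* Equality of rows would make [(i, b)] the rook [d] itself. *)
  rewrite negb_or => /andP[_]; rewrite -leqNgt leq_eqVlt => /orP[/eqP e|//].
  case/negP: ibP; rewrite (_ : (i, b) = d) //; case: d dP di e => d1 d2 /= _ -> e.
  by congr pair; apply: val_inj.
move=> /forall_inP Hf /forall_inP Ha; split.
  by apply/negP => ibP; have := Ha _ ibP; rewrite /= eqxx ltnn.
apply/forall_inP => d dP; rewrite /cancels negb_or /=; apply/andP; split.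
  apply/negP => /andP[/eqP e di]; have := PBC _ dP; rewrite inE => /orP[dB|].
    by have := Hf d; rewrite inE dP dB e eqxx => /(_ isT).
  by rewrite inE => /andP[/eqP e' _]; rewrite e' ltnn in di.
by apply/negP => /andP[di]; have := Ha d dP; rewrite di /=; lia.
Qed.

Lemma rooks_nw_column (P : {set cell}) (c : cell) :
  P \subset B :|: C -> (c.1 <= i)%N -> rooks_nw P c = rooks_nw (P :&: B) c.
Proof.
move=> /subsetP PBC ci; apply: eq_card => d; rewrite !inE.
case dP: (d \in P) => //=; have := PBC _ dP; rewrite !inE => /orP[-> //|/andP[/eqP -> _]].
by rewrite [(i < c.1)%N]ltnNge ci /= andbF.
Qed.

(** Two rooks in column [i] would attack each other, and a single one must avoid the rows of [Q]. *)
Lemma nonattacking_extensions (Q : {set cell}) : Q \subset B -> nonattacking Q ->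
  [set P : {set cell} | [&& P \subset B :|: C, nonattacking P & P :&: B == Q]] =
  Q |: [set (i, j) |: Q | j in [set j : 'I_n | (j < N)%N && free_row Q j]].
Proof.
move=> QB naQ; have iB j : (i, j) \notin B.
  by apply/negP => /B_left; rewrite ltnn.
have /nonattackingP[Q1 Q2] := naQ.
apply/setP => P; rewrite !inE; apply/and3P/orP.
  case=> /subsetP PBC /nonattackingP[P1 P2] /eqP PQ.
  have [PB|] := boolP (P \subset B); first by left; rewrite -PQ (setIidPl PB).
  case/subsetPn => -[a b] abP abB; right.
  have := PBC _ abP; rewrite !inE (negbTE abB) /= => /andP[/eqP ai bN].
  apply/imsetP; exists b.
    rewrite inE bN; apply/forall_inP => d; rewrite -PQ inE => /andP[dP dB].
    apply: contra abB => /eqP/val_inj e; rewrite (_ : (a, b) = d) //.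
    by apply: P2.
  apply/setP => d; rewrite -PQ !inE; apply/idP/orP => [dP|[/eqP ->|/andP[] //]]; last by rewrite -ai.
  have := PBC _ dP; rewrite !inE => /orP[dB|/andP[/eqP di _]]; first by right; rewrite dP.
  by left; apply/eqP; rewrite -ai; apply: P1; rewrite // di ai.
case=> [/eqP ->|/imsetP[j]].
  by split=> //; [apply: subset_trans QB (subsetUl _ _)|rewrite (setIidPl QB)].
rewrite inE => /andP[jN /forall_inP fj] ->.
have Qi d : d \in Q -> d.1 != i.
  by move=> /(subsetP QB)/B_left; apply: contraTneq => ->; rewrite ltnn.
split.
- apply/subsetP => d; rewrite !inE => /orP[/eqP ->|/(subsetP QB) ->//].
  by rewrite /= eqxx jN orbT.
- apply/nonattackingP; split=> c d; rewrite !inE.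
    move=> /orP[/eqP->|cQ] /orP[/eqP->|dQ] //= e; last exact: Q1.
      by have := Qi d dQ; rewrite -e eqxx.
    by have := Qi c cQ; rewrite e eqxx.
  move=> /orP[/eqP->|cQ] /orP[/eqP->|dQ] //= e; last exact: Q2.
    by have := fj d dQ; rewrite -e eqxx.
  by have := fj c cQ; rewrite e eqxx.
- apply/eqP/setP => d; rewrite !inE; case: eqP => [->|_] /=.
    by rewrite (negbTE (iB j)); apply/esym/negP => /(subsetP QB); apply/negP.
  by apply/andP/idP => [[]//|dQ]; rewrite dQ (subsetP QB).
Qed.

Context {R : pzRingType}.
Variables (x y : R) (w : nat -> nat -> R).
Hypothesis yx : y * x = w 1 1 * x * y + 1.
Hypothesis xw : forall s t, (0 < s)%N -> (0 < t)%N -> x * w s t = w s.+1 t * x.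
Hypothesis yw : forall s t, (0 < s)%N -> (0 < t)%N -> y * w s t = w s t.+1 * y.
Hypothesis ww : forall s t s' t', w s t * w s' t' = w s' t' * w s t.

Lemma placement_weight_column (P : {set cell}) : P \subset B :|: C ->
  placement_weight w (B :|: C) P = placement_weight w B (P :&: B) *
    \prod_(j < n | [&& (j < N)%N, free_row (P :&: B) j & above_new P j])
      w (i.+1 - rooks_nw (P :&: B) (i, j)) j.+1.
Proof.
move=> PBC; rewrite /placement_weight uncancelled_column // prod_comm_setU; first 1 last.
- by move=> c d; apply: ww.
- apply/pred0P => c /=; rewrite inE; apply/negP => /andP[].
  rewrite !inE => /andP[/andP[_ /B_left ci] _] /imsetP[j _ e].
  by rewrite e ltnn in ci.
rewrite prod_comm_imset; first 1 last.
- by move=> c d; apply: ww.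
- by move=> j j' [].
congr (_ * _).
  apply: eq_bigr => c; rewrite !inE => /andP[/andP[_ /B_left ci] _].
  by rewrite rooks_nw_column // ltnW.
by apply: eq_big => j; rewrite ?inE // => _; rewrite rooks_nw_column.
Qed.

Lemma card_placement_le (Q : {set cell}) : Q \subset B -> nonattacking Q -> (#|Q| <= i)%N.
Proof.
move=> /subsetP QB /nonattackingP[Q1 _].
apply: (card_le_bound Q (fun d => d.1 : nat)) => [c d cQ dQ /val_inj|d /QB/B_left //].
exact: Q1.
Qed.

(* Of the k rooks of Q, those above the free row j lower the first index and those
   below it lower the rank of j among the free rows; [weight_shift] absorbs the
   resulting diagonal shift. *)
Lemma column_weight (Q : {set cell}) (j : 'I_n) :
  Q \subset B -> nonattacking Q -> free_row Q j ->
  w (i.+1 - rooks_nw Q (i, j)) j.+1 =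
  w (i - #|Q|).+1 (count (free_row Q) (iota 0 j)).+1.
Proof.
move=> QB naQ /forall_inP fj; have := card_placement_le Q QB naQ.
(* All of [Q] is left of column [i] and none of it in row [j], so a rook that is not below row [j]
   is north-west of [(i, j)]. *)
have cQ : #|Q| = (#|[set d in Q | (d.2 < j)%N]| + rooks_nw Q (i, j))%N.
  rewrite /rooks_nw -(cardsID [set d : cell | (d.2 < j)%N] Q); congr addn.
    by apply: eq_card => d; rewrite !inE.
  apply: eq_card => d; rewrite !inE /=; case dQ: (d \in Q); rewrite ?andbF //= andbT.
  by rewrite (B_left _ (subsetP QB _ dQ)) /= -leqNgt leq_eqVlt eq_sym (negbTE (fj d dQ)).
have := count_free_row Q j naQ; set l := #|[set d in Q | _]| in cQ *; set r := count _ _ => rl ki.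
rewrite -(weight_shift _ _ _ yx xw yw ww l); congr w; lia.
Qed.

(** The predicate [p] covers both uses: all free rows when the new column is empty, the free rows
    above the new rook otherwise. *)
Lemma expX_column (Q : {set cell}) (p : pred nat) : Q \subset B -> nonattacking Q ->
  (\prod_(j < n | [&& (j < N)%N, free_row Q j & p j])
    w (i.+1 - rooks_nw Q (i, j)) j.+1) * x ^+ (i - #|Q|) =
  x ^+ (i - #|Q|) *
  \prod_(j < N | free_row Q j && p j) w 1 (count (free_row Q) (iota 0 j)).+1.
Proof.
move=> QB naQ; rewrite (expX_prod_weight _ _ xw).
rewrite (big_ord_widen_cond n (fun j => free_row Q j && p j)
  (fun j => w (i - #|Q|).+1 (count (free_row Q) (iota 0 j)).+1)) //.
congr (_ * _); apply: eq_big => j; first by rewrite andbC.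
by case/and3P=> _ fj _; apply: column_weight.
Qed.

(** Placements on the larger board are grouped by their trace [Q] on [B]; for each [Q], the terms of
    [expY_X] correspond one by one to the extensions of [Q]. *)
Lemma expansion_column :
  expansion w x y i N B * x = expansion w x y i.+1 N (B :|: C).
Proof.
rewrite /expansion mulr_suml; symmetry.
rewrite (partition_big (fun P => P :&: B) (fun Q => (Q \subset B) && nonattacking Q)); last first.
  move=> P /andP[_ naP]; rewrite subsetIr; apply: nonattackingS naP; exact: subsetIl.
apply: eq_bigr => Q /andP[QB naQ].
have QBC : Q \subset B :|: C by apply: subset_trans QB (subsetUl _ _).
have iB j : (i, j) \notin B by apply/negP => /B_left; rewrite ltnn.
have iQ j : (i, j) \notin Q by apply: contra (iB j); apply: (subsetP QB).
have ki := card_placement_le Q QB naQ.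
(* All rooks of [Q] lie below row [N], so the exponent of [y] counts the free rows, as [expY_X]
   requires. *)
have NkE : (N - #|Q|)%N = count (free_row Q) (iota 0 N).
  have := count_free_row Q N naQ; rewrite (_ : [set d in Q | (d.2 < N)%N] = Q); first by lia.
  by apply/setP => d; rewrite inE; case dQ: (d \in Q); rewrite //= B_low // (subsetP QB).
have extE j : ((i, j) |: Q) :&: B = Q.
  apply/setP => d; rewrite !inE; case: eqP => [->|_] /=; first by rewrite (negbTE (iB j)) (negbTE (iQ j)).
  by apply/andP/idP => [[]//|dQ]; rewrite dQ (subsetP QB).
rewrite (eq_bigl (mem [set P : {set cell} | [&& P \subset B :|: C, nonattacking P & P :&: B == Q]])); last first.
  by move=> P; rewrite !inE -andbA.
rewrite nonattacking_extensions // big_setU1 /=; last first.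
  by apply/imsetP => -[j _ e]; have := iQ j; rewrite e setU11.
rewrite big_imset /=; last first.
  move=> j j' _ _ e; have : (i, j) \in (i, j') |: Q by rewrite -e setU11.
  by rewrite in_setU1 (negbTE (iQ j)) orbF => /eqP[].
rewrite placement_weight_column // (setIidPl QB).
rewrite -!mulrA [in RHS]NkE (expY_X x y w yx yw ww) !mulrDr; congr (_ + _).
  (* No new rook: the exponent of [x] grows by one, and [above_new] holds vacuously. *)
  rewrite subSn // exprSr -NkE !mulrA; congr (_ * _ * _); rewrite -!mulrA; congr (_ * _).
  have := expX_column Q xpredT QB naQ.
  under [in X in X = _ -> _]eq_bigl => j do rewrite andbT.
  under [in X in _ = X -> _]eq_bigl => j do rewrite andbT.
  move=> <-; congr (_ * _); apply: eq_bigl => j.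
  rewrite (_ : above_new Q j = true) ?andbT //.
  apply/forall_inP => d dQ; apply/implyP => /eqP e.
  by have := B_left _ (subsetP QB _ dQ); rewrite e ltnn.
rewrite !mulr_sumr (big_ord_widen_cond n _ (fun j => placement_weight w B Q * (x ^+ (i - #|Q|) *
  (\prod_(j' < N | free_row Q j' && (j < j')%N) w 1 (count (free_row Q) (iota 0 j')).+1 *
    y ^+ (count (free_row Q) (iota 0 N)).-1)))) //.
apply: eq_big => j; first by rewrite inE andbC.
rewrite inE => /andP[jN fj].
rewrite placement_weight_column; last first.
  by apply/subsetP => d; rewrite !inE => /orP[/eqP ->|/(subsetP QB) ->//]; rewrite /= eqxx jN orbT.
(* A new rook: the exponent of [x] stays [i - #|Q|] and that of [y] drops by one. *)
rewrite extE cardsU1 iQ add1n subSS subnS -NkE -!mulrA; congr (_ * _).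
rewrite !mulrA; congr (_ * _).
rewrite -(expX_column Q (fun j' => j < j')%N QB naQ); congr (_ * _).
(* The new rook [(i, j)] is the only one in column [i], so [above_new] reduces to [j < j']. *)
apply: eq_bigl => j'; congr [&& _, _ & _].
apply/forall_inP/idP => [H|jj' d].
  by have := H (i, j); rewrite setU11 eqxx => /(_ isT).
rewrite !inE => /orP[/eqP ->|dQ]; first by rewrite jj' implybT.
by apply/implyP => /eqP e; have := B_left _ (subsetP QB _ dQ); rewrite e ltnn.
Qed.

End AddColumn.

(** * Expansion along the prefixes of a word *)

Section Words.

Context {R : pzRingType}.
Variables (x y : R) (w : nat -> nat -> R).
Hypothesis yx : y * x = w 1 1 * x * y + 1.
Hypothesis xw : forall s t, (0 < s)%N -> (0 < t)%N -> x * w s t = w s.+1 t * x.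
Hypothesis yw : forall s t, (0 < s)%N -> (0 < t)%N -> y * w s t = w s t.+1 * y.
Hypothesis ww : forall s t s' t', w s t * w s' t' = w s' t' * w s t.

(** Rooks lie in distinct rows below [b], so [#|P| <= b] and the subtraction in the exponent is
    exact. *)
Lemma expansion_row {m n : nat} (B : {set 'I_m * 'I_n}) (a b : nat) :
  (forall c, c \in B -> c.2 < b)%N ->
  expansion w x y a b B * y = expansion w x y a b.+1 B.
Proof.
move=> Bb; rewrite /expansion mulr_suml; apply: eq_bigr => P /andP[/subsetP PB naP].
rewrite -mulrA -exprSr subSn //; have /nonattackingP[_ P2] := naP.
apply: (card_le_bound P (fun d => d.2 : nat)) => [c d cP dP /val_inj|d /PB/Bb //].
exact: P2.
Qed.

Lemma expansion_set0 {m n : nat} (a b : nat) :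
  expansion w x y a b (set0 : {set 'I_m * 'I_n}) = x ^+ a * y ^+ b.
Proof.
rewrite /expansion (big_pred1 set0) => [|P]; last first.
  rewrite subset0; apply/andP/eqP => [[/eqP]//|->]; split=> //.
  by apply/nonattackingP; split=> c d; rewrite inE.
rewrite cards0 !subn0 /placement_weight big_pred0 ?mul1r // => c.
by rewrite !inE andbF.
Qed.

Lemma expansion_rook_number {m n : nat} (B : {set 'I_m * 'I_n}) :
  expansion w x y m n B =
  \sum_(0 <= k < (minn m n).+1) rook_number w k B * x ^+ (m - k) * y ^+ (n - k).
Proof.
have card_le P : nonattacking P -> (#|P : {set 'I_m * 'I_n}| <= minn m n)%N.
  move=> /nonattackingP[P1 P2]; rewrite leq_min; apply/andP; split.
    apply: (card_le_bound P (fun d => d.1 : nat)) => // c d cP dP /val_inj; exact: P1.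
  apply: (card_le_bound P (fun d => d.2 : nat)) => // c d cP dP /val_inj; exact: P2.
rewrite /expansion big_mkord.
(* Placements are grouped by size; [card_le] ensures that [inord] does not alter the size. *)
rewrite (partition_big (fun P : {set 'I_m * 'I_n} => inord #|P| : 'I_(minn m n).+1) xpredT) //=.
apply: eq_bigr => k _; rewrite /rook_number !mulr_suml.
have kE P : nonattacking P -> (inord #|P| == k) = (#|P : {set 'I_m * 'I_n}| == k).
  by move=> naP; rewrite -val_eqE /= inordK // ltnS card_le.
apply: eq_big => P.
  rewrite inE -andbA; case: (P \subset B) => //=.
  by case naP: (nonattacking P); rewrite ?andbF // andbT kE.
by move=> /andP[/andP[_ naP]]; rewrite kE // => /eqP ->.
Qed.

(** Counting from 0, the [LX] after [beta] has index [count_mem LX beta] among the [LX] and position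
    [size beta]. *)
Lemma height_cat (beta gamma : seq letter) :
  height (beta ++ LX :: gamma) (count_mem LX beta) = count_mem LY beta.
Proof.
have filterE : [seq p <- iota 0 (size beta) | nth LY (beta ++ LX :: gamma) p == LX] =
    [seq p <- iota 0 (size beta) | nth LY beta p == LX].
  by apply: eq_in_filter => p; rewrite mem_iota /= add0n nth_cat => ->.
have sizeE : size [seq p <- iota 0 (size beta) | nth LY beta p == LX] = count_mem LX beta.
  rewrite size_filter -[in RHS](mkseq_nth LY beta) /mkseq count_map.
  by apply: eq_count.
rewrite /height size_cat iotaD filter_cat filterE nth_cat sizeE ltnn subnn /= add0n.
by rewrite nth_cat ltnn subnn /= take_size_cat.
Qed.

Let value (l : letter) : R := if l is LX then x else y.

(** The height bound is carried along because it supplies the row bounds of [expansion_row] and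
    [expansion_column]. Quantifying over [gamma] lets the prefix grow while the full word stays
    fixed. *)
Lemma prefix_expansion (beta gamma : seq letter) (alpha := beta ++ gamma)
    (m := count_mem LX alpha) (n := count_mem LY alpha) (a := count_mem LX beta)
    (b := count_mem LY beta) :
  (forall k, (k < a)%N -> (height alpha k <= b)%N) /\
  \prod_(l <- beta) value l =
    expansion w x y a b [set c in board m n alpha | (c.1 < a)%N].
Proof.
rewrite {}/a {}/b {}/m {}/n {}/alpha.
elim/last_ind: beta gamma => [|beta l IH] gamma.
  split=> //; rewrite big_nil (_ : [set c in _ | _] = set0) ?expansion_set0 ?mulr1 //.
  by apply/setP => c; rewrite !inE andbF.
have [low prodE] := IH (l :: gamma); rewrite cat_rcons -cats1 big_cat big_seq1 /= prodE.
move: low; have lX : l = LX -> height (beta ++ l :: gamma) (count_mem LX beta) = count_mem LY beta.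
  by move=> ->; apply: height_cat.
have : (count_mem LX beta + (l == LX) <= count_mem LX (beta ++ l :: gamma))%N.
  by rewrite count_cat /= addnA leq_addr.
have : (count_mem LY beta <= count_mem LY (beta ++ l :: gamma))%N by rewrite count_cat leq_addr.
move: (beta ++ l :: gamma) lX => alpha lX len lem low.
rewrite !count_cat /= !addn0; case: l {IH prodE} lX lem => lX; rewrite /= ?addn0 ?addn1 => lem.
- have hE := lX erefl; split=> [k|].
    by rewrite ltnS leq_eqVlt => /orP[/eqP ->|/low //]; rewrite hE.
  rewrite (expansion_column _ (Ordinal lem) _ len _ _ x y w yx xw yw ww) /=.
  (* The columns up to the new one are the old columns and column [count_mem LX beta], whose height
     is given by [hE]. *)
  + congr expansion; apply/setP => c; rewrite !inE -val_eqE /= ltnS [(c.1 <= _)%N]leq_eqVlt.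
    case: eqP => [e|_] /=; rewrite ?andbF ?orbF //. by rewrite e hE ltnn andbF andbT.
  + by move=> c; rewrite !inE => /andP[].
  + by move=> c; rewrite !inE => /andP[ch /low]; apply: leq_trans.
- split=> [k /low kl|]; first exact: leqW.
  by apply: expansion_row => c; rewrite !inE => /andP[ch /low]; apply: leq_trans.
Qed.

Lemma prod_rook_expansion (alpha : seq letter)
    (m := count_mem LX alpha) (n := count_mem LY alpha) :
  \prod_(l <- alpha) value l =
  \sum_(0 <= k < (minn m n).+1)
    rook_number w k (board m n alpha) * x ^+ (m - k) * y ^+ (n - k).
Proof.
have [_ ->] := prefix_expansion alpha [::]; rewrite cats0 -expansion_rook_number.
by congr expansion; apply/setP => c; rewrite !inE ltn_ord andbT.
Qed.

End Words.

Theorem theorem4p1 (K : comNzRingType) (m n : nat) (alpha : seq letter)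
    (alpha_x : count_mem LX alpha = m) (alpha_y : count_mem LY alpha = n) :
  word_val K alpha =
    \sum_(0 <= k < (minn m n).+1)
      rook_number (@wW K) k (board m n alpha) * xW ^+ (m - k) * yW ^+ (n - k).
Proof.
subst m n.
exact: (prod_rook_expansion xW yW (@wW K) (yx_walg K) (@xw_walg K) (@yw_walg K) (@ww_walg K)).
Qed.
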